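(* There is an absolute constant $C\ge 3$ such that the following holds. Let $H$ be a finite linear hypergraph with no edges of rank $1$, maximum rank $P$ and maximum degree $\Delta$. If $P\ge C$ and $\Delta\ge C(P-1)$, then $q(H)\le \Delta(P-1)-1$.
   Context: A hypergraph $H=(V,E)$ is a finite set $V$ with a set $E$ of subsets of $V$ (edges). The rank of an edge is its cardinality; the degree of a vertex is the number of edges containing it. $H$ is linear if any two distinct edges share at most one vertex. An edge coloring of $H$ is a map $\gamma:E\to\Gamma$ such that $\gamma(e)=\gamma(f)$ for distinct edges $e,f$ only if $e\cap f=\emptyset$; the chromatic index $q(H)$ is the minimum $|\Gamma|$ over all edge colorings. *)

(* Defs.v *)
From mathcomp Require Import all_boot.
Set Implicit Arguments.
Unset Strict Implicit.
Unset Printing Implicit Defensive.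

(* A hypergraph on the finite vertex type V is given by its edge set
   E : {set {set V}}; an edge may have any cardinality, including 0. *)

Definition degree (V : finType) (E : {set {set V}}) (v : V) : nat :=
  #|[set e in E | v \in e]|.

Definition max_rank (V : finType) (E : {set {set V}}) : nat :=
  \max_(e in E) #|e|.

Definition max_degree (V : finType) (E : {set {set V}}) : nat :=
  \max_(v : V) degree E v.

Definition linear_hypergraph (V : finType) (E : {set {set V}}) : Prop :=
  forall e f : {set V}, e \in E -> f \in E -> e != f -> #|e :&: f| <= 1.

(* The colouring is defined on E only, so that the hypergraph without edges
   has chromatic index 0. *)
Definition edge_coloring (V : finType) (E : {set {set V}}) (Gamma : finType)
    (g : {ffun {e : {set V} | e \in E} -> Gamma}) : bool :=
  [forall e, forall f,
     (e != f) && (g e == g f) ==> (val e :&: val f == set0)].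

Definition edge_colorable (V : finType) (E : {set {set V}}) (k : nat) : bool :=
  [exists g : {ffun {e : {set V} | e \in E} -> 'I_k}, edge_coloring g].

Lemma edge_colorable_exists (V : finType) (E : {set {set V}}) :
  exists k, edge_colorable E k.
Proof.
exists #|{: {e : {set V} | e \in E}}|; apply/existsP.
exists [ffun e => enum_rank e]; apply/forallP => e; apply/forallP => f.
rewrite !ffunE; apply/implyP => /andP[ef /eqP /enum_rank_inj eqef].
by rewrite eqef eqxx in ef.
Qed.

Definition chromatic_index (V : finType) (E : {set {set V}}) : nat :=
  ex_minn (edge_colorable_exists E).

(* Main.v *)
(** Two adjacent vertices of the line graph of [E] have few common neighbours
    compared with the degree bound [D = P * Delta], so it suffices to colour
    graphs with sparse neighbourhoods with slightly fewer than [D] colours.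
    Show by induction on [S] that, for a uniformly random proper colouring of
    [S], the expected number of colours available at any vertex [v] is at least
    [D / 10]; in particular proper colourings exist.  By
    size-biasing, the induction hypothesis implies that few neighbours of [v]
    have fewer than [D / 100] available colours.  Fix the colours outside the
    neighbourhood [N] of [v].  The remaining neighbours [u] have long lists
    [L u] and few neighbours within [N], hence take a given colour with
    conditional probability about [1 / #|L u|] at most, and a colour [c] is
    missed by all of them with probability about
    [\prod_(u | c \in L u) (1 - 1 / #|L u|)].  Summed over [c] this is a
    constant proportion of [D], because the sum over [c] of
    [\sum_(u | c \in L u) 1 / #|L u|] is at most [D], about the number of
    colours. *)

Require Import Defs.
From mathcomp Require Import all_boot all_order all_algebra lra zify.

Set Implicit Arguments.
Unset Strict Implicit.
Unset Printing Implicit Defensive.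

Import Order.TTheory GRing.Theory Num.Theory.

(** * Elementary sums and product inequalities *)

Section Counting.

Local Open Scope ring_scope.

Variable R : realFieldType.

Lemma natr_card (T : finType) (A : {set T}) :
  #|A|%:R = \sum_x (x \in A)%:R :> R.
Proof.
rewrite -sum1_card natr_sum big_mkcond /=.
by apply: eq_bigr => x _; case: (x \in A).
Qed.

Lemma sumr_const_natr (T : finType) (A : {pred T}) (x : R) :
  \sum_(i in A) x = #|A|%:R * x.
Proof. by rewrite sumr_const mulr_natl. Qed.

(** Weierstrass product inequality; the induction step needs the upper bound [1] for the tail of the
    product. *)
Lemma prod_one_sub_ge (I : eqType) (r : seq I) (p : I -> R) :
    (forall i, i \in r -> 0 <= p i <= 1) ->
  1 - \sum_(i <- r) p i <= \prod_(i <- r) (1 - p i) <= 1.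
Proof.
elim: r => [|i r IH] pP; first by rewrite !big_nil; lra.
rewrite !big_cons.
have /andP[p0 p1] := pP i (mem_head _ _).
have {}IH : 1 - \sum_(j <- r) p j <= \prod_(j <- r) (1 - p j) <= 1.
  by apply: IH => j jr; apply: pP; rewrite in_cons jr orbT.
set s := \sum_(_ <- _) _ in IH *; set t := \prod_(_ <- _) _ in IH *.
have t0 : 0 <= t.
  rewrite /t big_seq; apply: prodr_ge0 => j jr; rewrite subr_ge0.
  by have := pP j; rewrite in_cons jr orbT => /(_ isT) /andP[].
by apply/andP; split; nra.
Qed.

(* Tangent line to [x ^+ 2] at [1 / 2], after comparing [1 - p] with a square. *)
Lemma prod_one_sub_ge_tangent (I : eqType) (r : seq I) (p : I -> R) :
    (forall i, i \in r -> 0 <= p i <= 7 / 100) ->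
  3 / 4 - 51 / 100 * \sum_(i <- r) p i <= \prod_(i <- r) (1 - p i).
Proof.
move=> pP; set s := \sum_(_ <- _) _.
pose y := \prod_(i <- r) (1 - 51 / 100 * p i).
have y_ge : 1 - 51 / 100 * s <= y.
  have pP' i : i \in r -> 0 <= 51 / 100 * p i <= 1 by move=> /pP; lra.
  by have /andP[+ _] := prod_one_sub_ge pP'; rewrite -big_distrr.
have : y ^+ 2 <= \prod_(i <- r) (1 - p i).
  rewrite -prodrXl big_seq [leRHS]big_seq.
  apply: ler_prod => i /pP /andP[p0 p1].
  (* For [p > 0], [(1 - 51/100 * p) ^ 2 <= 1 - p] amounts to [2601 * p <= 200], which [p <= 7/100]
     ensures. *)
  have : 0 <= p i * (7 / 100 - p i) by rewrite mulr_ge0 ?subr_ge0.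
  by rewrite sqr_ge0 expr2 /=; nra.
have := sqr_ge0 (y - 1 / 2).
by move=> y2; apply: le_trans; move: y2; rewrite !expr2; nra.
Qed.

(** * Proper partial colourings and available colours *)

Variables (V : finType) (adj : rel V) (q : nat).
Hypotheses (adj_sym : symmetric adj) (adj_irr : irreflexive adj).

Local Notation coloring := {ffun V -> 'I_q}.
Implicit Types (S N : {set V}) (s : coloring) (u v : V) (c : 'I_q).

(** A colouring of [S] is encoded as a total function with arbitrary values off [S]; hence the
    factor [q] whenever a vertex is removed from [S]. *)
Definition proper_on S : {set coloring} :=
  [set s : coloring | [forall u in S, forall w in S, adj u w ==> (s u != s w)]].

Definition avail S s u : {set 'I_q} :=
  [set c | [forall w in S, adj u w ==> (s w != c)]].

Definition recolor s u c : coloring := [ffun x => if x == u then c else s x].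

Lemma proper_onP S s :
  reflect {in S &, forall u w, adj u w -> s u != s w} (s \in proper_on S).
Proof.
rewrite inE; apply: (iffP forall_inP) => [H u w uS wS|H u uS].
  by move/forall_inP: (H u uS) => /(_ w wS) /implyP.
by apply/forall_inP => w wS; apply/implyP; apply: H.
Qed.

Lemma availP S s u c :
  reflect {in S, forall w, adj u w -> s w != c} (c \in avail S s u).
Proof.
rewrite inE; apply: (iffP forall_inP) => [H w wS|H w wS].
  by move/implyP: (H w wS).
by apply/implyP; apply: H.
Qed.

Lemma eq_avail S s s' u :
  {in S, forall w, adj u w -> s w = s' w} -> avail S s u = avail S s' u.
Proof.
move=> ss'; apply/setP => c.
by apply/availP/availP => H w wS uw; move: (H w wS uw); rewrite ss'.
Qed.

Lemma avail_mono S S' s u : S' \subset S -> avail S s u \subset avail S' s u.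
Proof.
move=> S'S; apply/subsetP => c /availP H; apply/availP => w wS'.
by apply: H; apply: (subsetP S'S).
Qed.

Lemma avail_recolor S s u c : avail S (recolor s u c) u = avail S s u.
Proof.
apply: eq_avail => w _ uw; rewrite ffunE; case: eqP uw => // ->.
by rewrite adj_irr.
Qed.

Lemma avail_setD1 S s u : avail (S :\ u) s u = avail S s u.
Proof.
apply/setP => c; apply/availP/availP => H w wS uw; apply: H => //.
  by rewrite !inE wS andbT; apply: contraTneq uw => ->; rewrite adj_irr.
by move: wS; rewrite inE => /andP[].
Qed.

Lemma recolor_id s u : recolor s u (s u) = s.
Proof. by apply/ffunP => x; rewrite ffunE; case: eqP => [->|]. Qed.

Lemma recolor2 s u c d : recolor (recolor s u c) u d = recolor s u d.
Proof. by apply/ffunP => x; rewrite !ffunE; case: eqP. Qed.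

Lemma recolorE s u c : recolor s u c u = c.
Proof. by rewrite ffunE eqxx. Qed.

Lemma proper_on_setD1 S s u : u \in S ->
  (s \in proper_on S) = (s \in proper_on (S :\ u)) && (s u \in avail S s u).
Proof.
move=> uS; apply/proper_onP/andP => [H|[/proper_onP H1 /availP H2] x y xS yS xy].
  split; first by apply/proper_onP => x y /setD1P[_ xS] /setD1P[_ yS]; apply: H.
  by apply/availP => w wS uw; rewrite eq_sym; apply: H.
have [xu|xu] := eqVneq x u.
  by rewrite xu eq_sym; apply: H2 => //; rewrite -xu.
have [yu|yu] := eqVneq y u.
  by rewrite yu; apply: H2 => //; rewrite -yu adj_sym.
by apply: H1; rewrite // !inE ?xu ?yu.
Qed.

(** * Counting by recolouring one vertex *)

Lemma proper_on_recolor S s u c : u \notin S ->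
  (recolor s u c \in proper_on S) = (s \in proper_on S).
Proof.
move=> uS; have e x : x \in S -> recolor s u c x = s x.
  by move=> xS; rewrite ffunE; case: eqP xS uS => // -> ->.
by apply/proper_onP/proper_onP => H x y xS yS xy; move: (H x y xS yS xy); rewrite !e.
Qed.

Lemma proper_on_recolor_avail S s u c : u \in S -> s \in proper_on S ->
  c \in avail S s u -> recolor s u c \in proper_on S.
Proof.
move=> uS; rewrite !(proper_on_setD1 _ uS) => /andP[sS _] cu.
rewrite proper_on_recolor ?setD11 // avail_recolor.
by rewrite sS recolorE cu.
Qed.

(* [(s, c) |-> (recolor s u c, s u)] is an involution. *)
Lemma sum_recolor u (G : coloring -> R) :
  \sum_s \sum_c G (recolor s u c) = q%:R * \sum_s G s.
Proof.
pose h (p : coloring * 'I_q) := (recolor p.1 u p.2, p.1 u).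
have hK : involutive h.
  by case=> s c; rewrite /h /= recolor2 recolor_id recolorE.
rewrite pair_big /= (reindex_inj (inv_inj hK)) /= /h /=.
under eq_bigr do rewrite recolor2 recolor_id.
rewrite -(pair_big predT predT (fun s _ => G s)) /= big_distrr /=.
by apply: eq_bigr => s _; rewrite sumr_const card_ord mulr_natl.
Qed.

(** The colour of [u] is chosen last: a colouring of [S :\ u] extends by exactly the available
    colours, and [Q], blind to the colour of [u], is unaffected. *)
Lemma card_recolorable S u (Q : pred coloring) : u \in S ->
    (forall s c, Q (recolor s u c) = Q s) ->
  q%:R * #|[set s in proper_on S | Q s]|%:R
    = \sum_(s in [set s in proper_on (S :\ u) | Q s]) #|avail S s u|%:R :> R.
Proof.
move=> uS Qrec; rewrite natr_card -(sum_recolor u) [RHS]big_mkcond /=.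
apply: eq_bigr => s _; rewrite inE.
transitivity (\sum_c ((s \in proper_on (S :\ u)) && Q s && (c \in avail S s u))%:R : R).
  apply: eq_bigr => c _; rewrite inE (proper_on_setD1 _ uS) Qrec.
  by rewrite proper_on_recolor ?setD11 // avail_recolor recolorE andbAC.
by case: (_ && _); rewrite /= ?natr_card // big1.
Qed.

Lemma card_proper_on S u : u \in S ->
  q%:R * #|proper_on S|%:R
    = \sum_(s in proper_on (S :\ u)) #|avail (S :\ u) s u|%:R :> R.
Proof.
move=> uS; have := @card_recolorable S u predT uS (fun _ _ => erefl).
have e (A : {set coloring}) : [set s in A | predT s] = A.
  by apply/setP => s; rewrite in_set andbT.
by rewrite !e => ->; apply: eq_bigr => s _; rewrite avail_setD1.
Qed.

(* Size-biasing: a colouring of [S] leaves few choices at [u] only rarely,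
   because it is obtained from one of [S :\ u] by making such a choice. *)
Lemma card_small_avail S u (b T : R) : u \in S -> 0 < b -> 0 <= T ->
    b * #|proper_on (S :\ u)|%:R
      <= \sum_(s in proper_on (S :\ u)) #|avail (S :\ u) s u|%:R ->
  b * #|[set s in proper_on S | #|avail S s u|%:R < T]|%:R
    <= T * #|proper_on S|%:R.
Proof.
move=> uS b0 T0 avg.
have qS := card_proper_on uS.
have qB := @card_recolorable S u (fun s => #|avail S s u|%:R < T) uS.
have {}qB := qB (fun s c => congr1 (fun A : {set 'I_q} => #|A|%:R < T) (avail_recolor S s u c)).
set x := #|proper_on S|%:R in qS *; set y := #|_|%:R in qB *.
set z := #|proper_on (S :\ u)|%:R in avg.
have le1 : q%:R * y <= T * z.
  rewrite qB /z natr_card big_distrr /= [leLHS]big_mkcond.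
  apply: ler_sum => s _; rewrite inE; case: (s \in proper_on _) => /=; last by rewrite mulr0.
  by case: ltP => [/ltW|]; rewrite mulr1.
have le2 : b * z <= q%:R * x.
  by rewrite qS.
have [q0|q0] := posnP q.
  suff -> : y = 0 by rewrite mulr0 mulr_ge0 ?ler0n.
  apply/eqP; rewrite pnatr_eq0 cards_eq0; apply/eqP/setP => s.
  by exfalso; have := leq_ltn_trans (leq0n _) (ltn_ord (s u)); rewrite q0.
have q0' : 0 < q%:R :> R by rewrite ltr0n.
have le1' : b * (q%:R * y) <= b * (T * z) by rewrite ler_pM2l.
have le2' : T * (b * z) <= T * (q%:R * x) by rewrite ler_wpM2l.
by rewrite -(ler_pM2l q0'); lra.
Qed.

(** Group [A] by the colours off [u]: a class with a member giving [u] the colour [c] has exactly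
    one such member, and at least [l] members in all. *)
Lemma card_recolor_le (A : {set coloring}) u c (l : R) :
    (forall s, s \in A -> s u = c ->
       l <= #|[set x | recolor s u x \in A]|%:R) ->
  l * #|[set s in A | s u == c]|%:R <= #|A|%:R.
Proof.
move=> lA; have [q0|q0] := posnP q.
  by exfalso; have := leq_ltn_trans (leq0n _) (ltn_ord c); rewrite q0.
have q0' : 0 < q%:R :> R by rewrite ltr0n.
rewrite -(ler_pM2l q0') mulrCA !natr_card -!(sum_recolor u) big_distrr /=.
apply: ler_sum => s _; rewrite (bigD1 c) //= big1 => [|x /negPf xc]; last first.
  by rewrite inE recolorE xc andbF.
rewrite inE recolorE eqxx andbT addr0.
have [sA|_] := boolP (recolor s u c \in A); last first.
  by rewrite mulr0 sumr_ge0.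
rewrite mulr1; apply: le_trans (lA _ sA (recolorE s u c)) _.
rewrite natr_card; apply: ler_sum => x _.
by rewrite inE recolor2.
Qed.

(** * Conditioning on the colours outside a set *)

Lemma card_avail_setD S N s u (K : nat) : u \in N ->
    (#|[set w in N | adj u w]| <= K)%N ->
  (#|avail (S :\: N) s u| <= #|avail S s u| + K)%N.
Proof.
move=> uN NK; apply: leq_trans (leq_add (leqnn _) NK).
(* A colour lost by restoring [N] is used by a neighbour of [u] in [N]. *)
apply: leq_trans (leq_add (leqnn _) (leq_imset_card s _)).
apply: leq_trans (leq_card_setU _ _); apply/subset_leq_card/subsetP => c /availP cu.
rewrite inE; have [//|] := boolP (c \in avail S s u) => /=.
apply: contraNT => cN; apply/availP => w wS uw.
have [wN|wN] := boolP (w \in N); last by apply: cu; rewrite // inE wN.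
apply: contraNneq cN => <-; apply: imset_f; by rewrite inE wN.
Qed.

(* [fiber c0 S N rho] fixes the colours outside [N]; [c0] is a dummy colour. *)
Definition restr (c0 : 'I_q) N s : coloring :=
  [ffun x => if x \in N then c0 else s x].

Definition fiber c0 S N (rho : coloring) : {set coloring} :=
  [set s in proper_on S | restr c0 N s == rho].

Lemma restr_recolor c0 N s u c : u \in N ->
  restr c0 N (recolor s u c) = restr c0 N s.
Proof.
move=> uN; apply/ffunP => x; rewrite !ffunE; case: ifP => // xN.
by case: eqP xN uN => // -> ->.
Qed.

Lemma avail_fiber c0 S N rho s u : s \in fiber c0 S N rho ->
  avail (S :\: N) s u = avail (S :\: N) rho u.
Proof.
rewrite inE => /andP[_ /eqP <-]; apply: eq_avail => w.
by rewrite inE ffunE => /andP[/negPf ->].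
Qed.

Lemma sum_fibers c0 S N (F : coloring -> R) :
  \sum_(s in proper_on S) F s = \sum_rho \sum_(s in fiber c0 S N rho) F s.
Proof.
rewrite (partition_big (restr c0 N) predT) //=.
by apply: eq_bigr => rho _; apply: eq_bigl => s; rewrite [RHS]inE.
Qed.

(** Chain rule over [W]. Among the colourings in which the later entries of the list avoid [c], the
    next vertex [u] can be recoloured with any colour of [avail S s u] without leaving this set.
    There are at least [#|L| - K] of these, so at most a proportion [1 / (#|L| - K)] gives [u] the
    colour [c]. *)
Lemma card_avoid_ge c0 S N rho (K : nat) c (W : seq V) :
    N \subset S -> {in N, forall u, #|[set w in N | adj u w]| <= K}%N ->
    uniq W -> {subset W <= N} ->
    {in W, forall u, K < #|avail (S :\: N) rho u|}%N ->
  #|fiber c0 S N rho|%:R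
    * \prod_(u <- W) (1 - (c \in avail (S :\: N) rho u)%:R
                          / (#|avail (S :\: N) rho u|%:R - K%:R))
  <= #|[set s in fiber c0 S N rho | all (fun u => s u != c) W]|%:R :> R.
Proof.
move=> NS NK; elim: W => [_ _ _|u W IH /= /andP[uW uniqW] WN KW].
  rewrite big_nil mulr1 ler_nat subset_leq_card //.
  by apply/subsetP => s sF; rewrite inE sF.
have uN : u \in N by apply: WN; rewrite mem_head.
have {}IH := IH uniqW (fun w wW => WN w (mem_behead (s := u :: W) wW))
                     (fun w wW => KW w (mem_behead (s := u :: W) wW)).
rewrite big_cons; set A := [set s in _ | all _ W] in IH.
set L := avail _ rho u; set p := _ / _.
have KL : (K < #|L|)%N by apply: KW; rewrite mem_head.
have l_ge1 : 1 <= #|L|%:R - K%:R :> R by rewrite lerBrDr nat1r ler_nat.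
have pA : #|[set s in A | s u == c]|%:R <= p * #|A|%:R.
  have cL s : s \in A -> s u = c -> c \in L.
    rewrite inE => /andP[sF _] suc; rewrite /L -(avail_fiber u sF).
    apply: (subsetP (avail_mono _ _ (subsetDl S N))).
    move: sF; rewrite inE => /andP[].
    by rewrite (proper_on_setD1 _ (subsetP NS _ uN)) suc => /andP[].
  rewrite /p; have [cL'|cL'] := boolP (c \in L); last first.
    rewrite mul0r mul0r (_ : [set s in A | s u == c] = set0) ?cards0 //.
    apply/eqP; rewrite -subset0; apply/subsetP => s; rewrite in_set => /andP[sA /eqP suc].
    by rewrite (cL s) in cL'.
  rewrite mul1r mulrC ler_pdivlMr ?(lt_le_trans ltr01) // mulrC.
  apply: card_recolor_le => s sA suc.
  rewrite lerBlDr -natrD ler_nat.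
  have sF : s \in fiber c0 S N rho by move: sA; rewrite inE => /andP[].
  rewrite /L -(avail_fiber u sF).
  apply: leq_trans (card_avail_setD S s uN (NK u uN)) _; rewrite leq_add2r.
  apply/subset_leq_card/subsetP => x xu; rewrite in_set in_set.
  move: sF; rewrite inE => /andP[sS srho].
  rewrite in_set restr_recolor // srho andbT.
  rewrite proper_on_recolor_avail ?(subsetP NS) //=.
  move: sA; rewrite inE => /andP[_ /allP sW]; apply/allP => w wW.
  rewrite ffunE; have [wu|_] := eqVneq w u; last exact: sW.
  by rewrite -wu wW in uW.
have cardA : (#|A| = #|[set s in fiber c0 S N rho | (s u != c) && all (fun u => s u != c) W]|
   + #|[set s in A | s u == c]|)%N.
  rewrite -(cardsID [set s : coloring | s u == c] A) addnC; congr addn.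
    apply: eq_card => s; rewrite !in_set -/(s \in fiber c0 S N rho).
    by rewrite andbCA.
  by apply: eq_card => s; rewrite !in_set.
have p_le1 : p <= 1.
  rewrite /p ler_pdivrMr ?(lt_le_trans ltr01) // mul1r.
  by apply: le_trans l_ge1; case: (_ \in _).
have {}cardA : #|A|%:R = _ :> R := congr1 _ cardA.
rewrite natrD in cardA.
apply: le_trans (_ : (1 - p) * #|A|%:R <= _); last by lra.
by rewrite mulrCA ler_wpM2l // subr_ge0.
Qed.

(** * Expected number of available colours *)

Definition small_avail S N (T : R) s : {set V} :=
  [set u in N | #|avail (S :\: N) s u|%:R < T].

(** A colour missed by all neighbours with long lists is available at [v] unless a neighbour with a
    short list uses it; [small_avail] pays for these exceptions. *)
Lemma fiber_sum_avail_ge c0 S v rho (K : nat) (T : R) :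
    let N := [set u in S | adj v u] in
    {in N, forall u, #|[set w in N | adj u w]| <= K}%N ->
    20 * K%:R <= T -> 16 <= T ->
  #|fiber c0 S N rho|%:R * (3 / 4 * q%:R - 102 / 190 * #|N|%:R)
  <= \sum_(s in fiber c0 S N rho)
        (#|avail S s v|%:R + #|small_avail S N T s|%:R) :> R.
Proof.
move=> N NK KT T16; set F := fiber c0 S N rho.
pose L u := avail (S :\: N) rho u.
pose M := [set u in N | T <= #|L u|%:R].
have NS : N \subset S by apply/subsetP => u; rewrite inE => /andP[].
have K0 : 0 <= K%:R :> R by [].
have per_color c : #|F|%:R * (3 / 4 - 51 / 100 *
      \sum_(u <- enum M) (c \in L u)%:R / (#|L u|%:R - K%:R))
    <= #|[set s in F | all (fun u => s u != c) (enum M)]|%:R :> R.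
  have MN : {subset enum M <= N} by move=> u; rewrite mem_enum inE => /andP[].
  have KM : {in enum M, forall u, K < #|L u|}%N.
    by move=> u; rewrite mem_enum inE => /andP[_ TL]; rewrite -(ltr_nat R); lra.
  apply: le_trans (card_avoid_ge c0 c NS NK (enum_uniq M) MN KM).
  apply: ler_wpM2l; first exact: ler0n.
  (* Here [#|L u| - K >= 19/20 * T >= 15.2], so each probability is below [7/100]. *)
  apply: prod_one_sub_ge_tangent => u; rewrite mem_enum inE => /andP[_ TL].
  rewrite divr_ge0 //=; last by lra.
  rewrite ler_pdivrMr; last by lra.
  by case: (_ \in _); rewrite /=; lra.
have sum_colors : \sum_(c : 'I_q) #|[set s in F | all (fun u => s u != c) (enum M)]|%:R
    = \sum_(s in F) #|[set c : 'I_q | all (fun u => s u != c) (enum M)]|%:R :> R.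
  under eq_bigr do rewrite natr_card.
  rewrite exchange_big /= [RHS]big_mkcond; apply: eq_bigr => s _.
  rewrite natr_card; case: ifP => sF; last first.
    by rewrite big1 // => c _; rewrite inE sF.
  by apply: eq_bigr => c _; rewrite in_set in_set sF.
apply: le_trans (_ : \sum_(s in F)
    #|[set c : 'I_q | all (fun u => s u != c) (enum M)]|%:R <= _); last first.
  apply: ler_sum => s sF; rewrite -natrD ler_nat.
  apply: leq_trans (leq_add (leqnn _) (leq_imset_card s _)).
  apply: leq_trans (leq_card_setU _ _).
  apply/subset_leq_card/subsetP => c; rewrite in_set => /allP cM; rewrite in_setU.
  have [//|] := boolP (c \in avail S s v) => /=.
  apply: contraNT => cN; apply/availP => w wS vw.
  have wN : w \in N by rewrite inE wS.
  have [wM|wM] := boolP (w \in M); first by apply: cM; rewrite mem_enum.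
  apply: contraNneq cN => <-; apply: imset_f; rewrite inE wN /=.
  by rewrite (avail_fiber w sF); move: wM; rewrite inE wN /= -ltNge.
rewrite -sum_colors; apply: le_trans (ler_sum _ (fun c _ => per_color c)).
rewrite -big_distrr /= ler_wpM2l // sumrB sumr_const_natr card_ord [_ * (3 / 4)]mulrC.
rewrite -big_distrr /= exchange_big /= big_enum /= lerD2l lerN2.
(* Each [u] contributes [#|L u| / (#|L u| - K) <= 20/19] over all colours, and
   [51/100 * 20/19 = 102/190]. *)
apply: le_trans (_ : 51 / 100 * \sum_(u in M) 20 / 19 <= _).
  apply: ler_wpM2l; first by lra.
  apply: ler_sum => u; rewrite inE => /andP[_ TL].
  rewrite -big_distrl /= -natr_card ler_pdivrMr; lra.
rewrite sumr_const_natr.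
have : #|M|%:R <= #|N|%:R :> R.
  by rewrite ler_nat subset_leq_card //; apply/subsetP => u; rewrite inE => /andP[].
lra.
Qed.

Lemma sum_avail_ge S v (D K : nat) : (0 < q)%N ->
    let N := [set u in S | adj v u] in
    (#|N| <= D)%N -> {in N, forall u, #|[set w in N | adj u w]| <= K}%N ->
    (2000 * K <= D)%N -> (1600 <= D)%N -> (99 * D <= 100 * q)%N ->
    {in S, forall u, D%:R / 10 * #|proper_on (S :\ u)|%:R
      <= \sum_(s in proper_on (S :\ u)) #|avail (S :\ u) s u|%:R :> R} ->
  D%:R / 10 * #|proper_on S|%:R
    <= \sum_(s in proper_on S) #|avail S s v|%:R :> R.
Proof.
move=> q0 N ND NK; rewrite -!(ler_nat R) !natrM => KD D0 Dq IH.
rewrite -(ler_nat R) in ND.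
(* With [T = D/100], the bounds on [K] and [D] become [20 * K <= T] and [16 <= T]. *)
pose c0 := Ordinal q0; pose T : R := D%:R / 100.
have NS : N \subset S by apply/subsetP => u; rewrite inE => /andP[].
have bad : \sum_(s in proper_on S) #|small_avail S N T s|%:R
    <= D%:R / 10 * #|proper_on S|%:R :> R.
  have -> : \sum_(s in proper_on S) #|small_avail S N T s|%:R
     = \sum_(u in N) #|[set s in proper_on S | #|avail (S :\: N) s u|%:R < T]|%:R :> R.
    under eq_bigr do rewrite natr_card.
    rewrite exchange_big /= [RHS]big_mkcond; apply: eq_bigr => u _.
    rewrite natr_card big_mkcond; case: ifP => uN; last first.
      by rewrite big1 // => s _; case: ifP => // _; rewrite inE uN.
    apply: eq_bigr => s _; rewrite [in RHS]in_set.
    by case: (s \in proper_on S) => //=; rewrite inE uN.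
  apply: le_trans (_ : \sum_(u in N) #|proper_on S|%:R / 10 <= _); last first.
    rewrite sumr_const_natr; have : 0 <= #|proper_on S|%:R :> R by [].
    nra.
  (* Size-biasing gives each [u] a short list with probability at most [(D/100) / (D/10) = 1/10].
     Forgetting [N] only lengthens lists, so the bound for [S] carries over to [S :\: N]. *)
  apply: ler_sum => u uN; have uS := subsetP NS _ uN.
  have := @card_small_avail S u (D%:R / 10) T uS _ _ (IH u uS).
  set X := #|proper_on S|%:R; set Y := #|_|%:R; set Z := #|_|%:R => YX.
  have ZY : Z <= Y.
    rewrite ler_nat subset_leq_card //; apply/subsetP => s.
    rewrite in_set [in X in _ -> X]in_set => /andP[-> /=]; apply: le_lt_trans.
    by rewrite ler_nat subset_leq_card // avail_mono // subsetDl.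
  have {}YX : D%:R / 10 * Y <= T * X by apply: YX; rewrite /T; lra.
  have D10 : 0 < D%:R / 10 :> R by lra.
  apply: le_trans ZY _; rewrite -(ler_pM2l D10); apply: le_trans YX _.
  by rewrite /T; lra.
have : \sum_(s in proper_on S) (3 / 4 * q%:R - 102 / 190 * #|N|%:R)
    <= \sum_(s in proper_on S) (#|avail S s v|%:R + #|small_avail S N T s|%:R) :> R.
  rewrite !(sum_fibers c0 S N); apply: ler_sum => rho _.
  rewrite sumr_const_natr.
  by apply: (@fiber_sum_avail_ge c0 S v rho K T NK); rewrite /T; lra.
rewrite sumr_const_natr big_split /=.
have : 0 <= #|proper_on S|%:R :> R by [].
set X := #|proper_on S|%:R => X0 le1.
(* [3/4 * 99/100 - 102/190 > 1/5]; short lists cost at most [D/10], leaving the [D/10] of the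
   induction. *)
have : X * (D%:R / 5) <= X * (3 / 4 * q%:R - 102 / 190 * #|N|%:R).
  by rewrite ler_wpM2l //; lra.
by lra.
Qed.

Lemma sparse_neighborhood_colorable (D K : nat) :
    (forall v, #|[set u | adj v u]| <= D)%N ->
    (forall v u, adj v u -> #|[set w | adj v w && adj u w]| <= K)%N ->
    (2000 * K <= D)%N -> (1600 <= D)%N -> (99 * D <= 100 * q)%N ->
  exists s : coloring, forall u w, adj u w -> s u != s w.
Proof.
move=> degD codegK KD D0 Dq.
have q0 : (0 < q)%N.
  by rewrite lt0n; apply: contraTneq Dq => ->; rewrite muln0 -ltnNge muln_gt0 (leq_trans _ D0).
have cardD1 S u n : u \in S -> (#|S| < n.+1 -> #|S :\ u| < n)%N.
  by move=> uS; rewrite (cardsD1 u S) uS.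
(* The vertex [v] stays arbitrary: the induction hypothesis is applied to [S :\ u] at the removed
   vertex [u]. *)
have avg S v : D%:R / 10 * #|proper_on S|%:R
    <= \sum_(s in proper_on S) #|avail S s v|%:R :> R.
  have [n] := ubnP #|S|; elim: n => // n IH in S v * => Sn.
  apply: (sum_avail_ge (K := K)) => // [|u|u uS]; last exact/IH/cardD1.
  - by apply: leq_trans (degD v); apply/subset_leq_card/subsetP => u; rewrite !inE => /andP[].
  - rewrite inE => /andP[_ vu]; apply: leq_trans (codegK v u vu).
    by apply/subset_leq_card/subsetP => w; rewrite !inE => /andP[/andP[_ ->]].
suff ex S : (0 < #|proper_on S|)%N.
  have /card_gt0P[s /proper_onP sP] := ex [set: V].
  by exists s => u w; apply: sP; rewrite inE.
have [n] := ubnP #|S|; elim: n => // n IH in S * => Sn.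
have [->|[u uS]] := set_0Vmem S.
  by apply/card_gt0P; exists [ffun=> Ordinal q0]; apply/proper_onP => u; rewrite inE.
have D1 : 0 < D%:R :> R by rewrite ltr0n (leq_trans _ D0).
rewrite -(ltr0n R) -(pmulr_rgt0 _ (_ : 0 < q%:R)) ?ltr0n //.
rewrite (card_proper_on uS); apply: lt_le_trans (avg _ _).
apply: mulr_gt0; first by rewrite divr_gt0 // ltr0n.
by rewrite ltr0n IH // cardD1.
Qed.

End Counting.

(** * Degrees and codegrees in the line graph *)

Section LineGraph.

Variables (V : finType) (E : {set {set V}}).

Local Notation edge := {e : {set V} | e \in E}.

Definition line_adj : rel edge :=
  fun e f => (e != f) && (val e :&: val f != set0).

Lemma line_adj_sym : symmetric line_adj.
Proof. by move=> e f; rewrite /line_adj eq_sym setIC. Qed.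

Lemma line_adj_irr : irreflexive line_adj.
Proof. by move=> e; rewrite /line_adj eqxx. Qed.

Lemma card_edges_at (x : V) :
  #|[set f : edge | x \in val f]| <= max_degree E.
Proof.
apply: leq_trans (leq_bigmax x); rewrite -(card_imset _ val_inj).
apply/subset_leq_card/subsetP => e /imsetP[f + ->].
by rewrite !inE (valP f).
Qed.

Lemma card_edge (e : edge) : #|val e| <= max_rank E.
Proof. exact: (leq_bigmax_cond _ (valP e)). Qed.

Lemma line_adj_degree (e : edge) :
  #|[set f | line_adj e f]| <= max_rank E * max_degree E.
Proof.
apply: leq_trans (_ : \sum_(x in val e) #|[set f : edge | x \in val f]| <= _); last first.
  apply: leq_trans (_ : \sum_(x in val e) max_degree E <= _).
    by apply: leq_sum => x _; apply: card_edges_at.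
  by rewrite sum_nat_const leq_mul2r card_edge orbT.
apply: leq_trans (_ : #|\bigcup_(x in val e) [set f : edge | x \in val f]| <= _).
  apply/subset_leq_card/subsetP => f; rewrite inE => /andP[_ /set0Pn[x]].
  by rewrite inE => /andP[xe xf]; apply/bigcupP; exists x; rewrite ?inE.
elim/big_rec2: _ => [|x n A _ IH]; first by rewrite cards0.
by apply: leq_trans (leq_card_setU _ _) _; rewrite leq_add2l.
Qed.

Hypothesis linE : linear_hypergraph E.

Lemma linear_edge_inj (f g : edge) (y z : V) : y != z ->
  y \in val f -> z \in val f -> y \in val g -> z \in val g -> f = g.
Proof.
move=> yz yf zf yg zg; apply/eqP; apply: contraTT isT => fg.
have := linE (valP f) (valP g) fg; rewrite leqNgt => /negP; case.
rewrite (cardsD1 y) (cardsD1 z) !inE yf yg zf zg.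
by rewrite eq_sym yz.
Qed.

(* A common neighbour of [e] and [f] passes through their common vertex, or is
   determined by the two distinct vertices at which it meets [e] and [f]. *)
Lemma line_adj_codegree (e f : edge) : line_adj e f ->
  #|[set g | line_adj e g && line_adj f g]|
    <= max_degree E + (max_rank E - 1) * (max_rank E - 1).
Proof.
case/andP=> ef /set0Pn[x]; rewrite inE => /andP[xe xf].
(* By linearity an edge through two distinct vertices is unique; [e] is a dummy value for pairs on
   no common edge. *)
pose through (p : V * V) : edge :=
  odflt e [pick g : edge | (p.1 \in val g) && (p.2 \in val g)].
have cardD1 (g : edge) : x \in val g -> #|val g :\ x| <= max_rank E - 1.
  by move=> xg; have := card_edge g; rewrite (cardsD1 x) xg add1n subn1; case: max_rank.
apply: leq_trans (_ : _ <= #|[set g : edge | x \in val g]|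
    + #|through @: setX (val e :\ x) (val f :\ x)|) _; last first.
  apply: leq_add (card_edges_at x) _.
  apply: leq_trans (leq_imset_card _ _) _; rewrite cardsX.
  by apply: leq_mul; apply: cardD1.
apply: leq_trans (leq_card_setU _ _).
apply/subset_leq_card/subsetP => g; rewrite !inE.
case/andP=> /andP[eg /set0Pn[y]] + /andP[fg /set0Pn[z]].
rewrite !inE => /andP[ye yg] /andP[zf zg].
have [//|xg /=] := boolP (x \in val g).
have yx : y != x by apply: contraNneq xg => <-.
have zx : z != x by apply: contraNneq xg => <-.
(* If [y = z], then [e] and [f] would share both [x] and [y]. *)
have yz : y != z.
  apply: contraNneq ef => yz; apply/eqP.
  by apply: (linear_edge_inj yx); rewrite // yz.
apply/imsetP; exists (y, z); first by rewrite !inE yx zx ye zf.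
rewrite /through; case: pickP => [h /= /andP[yh zh]|/(_ g)]; last by rewrite /= yg zg.
exact: (linear_edge_inj yz).
Qed.

End LineGraph.

Theorem theorem5 :
  exists C : nat, 3 <= C /\
    forall (V : finType) (E : {set {set V}}) (P Delta : nat),
      linear_hypergraph E ->
      (forall e : {set V}, e \in E -> #|e| <> 1) ->
      max_rank E = P ->
      max_degree E = Delta ->
      C <= P ->
      C * (P - 1) <= Delta ->
      chromatic_index E <= Delta * (P - 1) - 1.
Proof.
(* The sparsity condition is [2000 * (Delta + p ^ 2) <= P * Delta] with [p = P - 1]. Each of the two
   terms takes at most half of the right side, by [4000 <= P] and [4000 * p <= Delta]. *)
exists 4000; split=> // V E P Delta linE _ rankE degE CP CD.
have [p Pp] : exists p, P = p.+1 by case: P CP {rankE CD} => // p _; exists p.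
have Dge : 4000 * p <= Delta by move: CD; rewrite Pp subn1.
have pge : 3999 <= p by rewrite -ltnS -Pp.
pose q := Delta * p - 1.
have [s sP] : exists s : {ffun {e | e \in E} -> 'I_q},
    forall e f, line_adj e f -> s e != s f.
  apply: (@sparse_neighborhood_colorable rat _ _ q (@line_adj_sym _ E) (@line_adj_irr _ E)
            (P * Delta) (Delta + p * p)).
  - by move=> e; rewrite -rankE -degE line_adj_degree.
  - by move=> e f /(line_adj_codegree linE); rewrite rankE degE Pp subn1.
  - rewrite Pp; nia.
  - rewrite Pp; nia.
  (* For large [P], the [Delta + 1] colours saved are less than one percent of [P * Delta]. *)
  - rewrite Pp /q; nia.
have -> : Delta * (P - 1) - 1 = q by rewrite Pp subSS subn0.
rewrite /chromatic_index; case: ex_minnP => m _; apply.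
apply/existsP; exists s; apply/forallP => e; apply/forallP => f.
apply/implyP => /andP[ef /eqP sef]; apply: contraTT isT => ef0.
have /sP : line_adj e f by rewrite /line_adj ef.
by rewrite sef eqxx.
Qed.
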